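(* Let $L$ be the Cayley table of a finite loop $Q$ that has the right inverse property. Suppose that for all $p=(r_p,c_p,r_pc_p)\in X(L)$ and all $c\in Q-\{c_p\}$, the permutation $\pi=\pi_{L,p}$ satisfies both $\pi^2=\mathrm{id}$ and $\pi(c)=(c_pc^{-1})c_p$. Then $Q$ is a right Bol loop.
   Context: A quasigroup is a set $Q$ with a binary operation, written as juxtaposition, such that for all $a,b\in Q$ there exist unique $c,d\in Q$ with $ac=b$ and $da=b$. A loop is a quasigroup with a two-sided identity element $\iota$. A loop $Q$ has the right inverse property if every $b\in Q$ has a two-sided inverse $b^{-1}$ and $(ab)b^{-1}=a$ for all $a,b\in Q$. A right Bol loop is a loop $Q$ satisfying $((ca)b)a=c((ab)a)$ for all $a,b,c\in Q$. The Cayley table $L$ of a finite quasigroup $Q$ is the Latin square with rows and columns indexed by $Q$ and $(a,b)$-entry $L(a,b)=ab$. Put $X(L)=\{(a,b,ab)\mid a,b\in Q\}$; any two components of an element of $X(L)$ determine the third. For $p=(r_p,c_p,r_pc_p)\in X(L)$, the permutation $\pi=\pi_{L,p}$ of $Q-\{c_p\}$ is defined as follows. For $c\in Q-\{c_p\}$, let $x=(r_p,c,r_pc)\in X(L)$; let $y=(r,c_p,r_pc)$ be the unique element of $X(L)$ with second component $c_p$ and third component $r_pc$ (this determines $r$); let $z=(r,c',r_pc_p)$ be the unique element of $X(L)$ with first component $r$ and third component $r_pc_p$ (this determines $c'$). Then $\pi(c)=c'$. *)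

(* Defs.v *)
From mathcomp Require Import all_boot all_fingroup.

Set Implicit Arguments.
Unset Strict Implicit.
Unset Printing Implicit Defensive.

Definition quasigroup (Q : Type) (op : Q -> Q -> Q) : Prop :=
  forall a b, (exists! c, op a c = b) /\ (exists! d, op d a = b).

Record loop (Q : Type) (op : Q -> Q -> Q) (iota : Q) : Prop := Loop {
  loop_quasigroup : quasigroup op;
  loop_left_id : left_id iota op;
  loop_right_id : right_id iota op
}.

Definition right_inverse_property (Q : Type) (op : Q -> Q -> Q) (iota : Q)
    (inv : Q -> Q) : Prop :=
  (forall b, op b (inv b) = iota /\ op (inv b) b = iota) /\
  (forall a b, op (op a b) (inv b) = a).

Definition right_bol_loop (Q : Type) (op : Q -> Q -> Q) (iota : Q) : Prop :=
  loop op iota /\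
  (forall a b c, op (op (op c a) b) a = op c (op (op a b) a)).

Section LatinSquare.

Variable Q : finType.

Definition cell_row (x : Q * Q * Q) : Q := x.1.1.
Definition cell_col (x : Q * Q * Q) : Q := x.1.2.
Definition cell_sym (x : Q * Q * Q) : Q := x.2.

(* The Cayley table of a quasigroup is the operation itself, seen as a Latin
   square L with (a, b)-entry L a b. *)
Variable L : Q -> Q -> Q.

Definition cells : {set Q * Q * Q} := [set (a, b, L a b) | a : Q, b : Q].

Lemma cellsE x : (x \in cells) = (L (cell_row x) (cell_col x) == cell_sym x).
Proof.
apply/imset2P/eqP => [[a b _ _ ->] // | ].
by case: x => [[a b] s] /= E; exists a b => //; rewrite -E.
Qed.

Hypothesis HL : quasigroup L.

Lemma row_sym_ex r s :
  exists x, [&& x \in cells, cell_row x == r & cell_sym x == s].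
Proof.
have [[c [Ec _]] _] := HL r s; exists (r, c, s).
by rewrite cellsE /cell_row /cell_col /cell_sym /= Ec !eqxx.
Qed.

Lemma col_sym_ex c s :
  exists x, [&& x \in cells, cell_col x == c & cell_sym x == s].
Proof.
have [_ [r [Er _]]] := HL c s; exists (r, c, s).
by rewrite cellsE /cell_row /cell_col /cell_sym /= Er !eqxx.
Qed.

Definition row_sym_cell (r s : Q) : Q * Q * Q := xchoose (row_sym_ex r s).
Definition col_sym_cell (c s : Q) : Q * Q * Q := xchoose (col_sym_ex c s).

Lemma row_sym_cellP r s x :
  [/\ x \in cells, cell_row x = r & cell_sym x = s] <-> x = row_sym_cell r s.
Proof.
have /and3P[yX /eqP yr /eqP ys] := xchooseP (row_sym_ex r s).
split=> [[xX xr xs] | ->]; last by [].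
have [[c [_ cU]] _] := HL r s.
move: xX yX; rewrite !cellsE -/(row_sym_cell r s).
rewrite /row_sym_cell; move: (xchoose _) yr ys => [[yr' yc] ys'].
case: x xr xs => [[xr' xc] xs']; rewrite /cell_row /cell_col /cell_sym /=.
by move=> -> -> -> -> /eqP/cU <- /eqP/cU <-.
Qed.

Lemma col_sym_cellP c s x :
  [/\ x \in cells, cell_col x = c & cell_sym x = s] <-> x = col_sym_cell c s.
Proof.
have /and3P[yX /eqP yc /eqP ys] := xchooseP (col_sym_ex c s).
split=> [[xX xc xs] | ->]; last by [].
have [_ [r [_ rU]]] := HL c s.
move: xX yX; rewrite !cellsE.
rewrite /col_sym_cell; move: (xchoose _) yc ys => [[yr yc'] ys'].
case: x xc xs => [[xr xc'] xs']; rewrite /cell_row /cell_col /cell_sym /=.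
by move=> -> -> -> -> /eqP/rU <- /eqP/rU <-.
Qed.

Definition pi_fun (p : Q * Q * Q) (c : Q) : Q :=
  let x := (cell_row p, c, L (cell_row p) c) in
  let y := col_sym_cell (cell_col p) (cell_sym x) in
  let z := row_sym_cell (cell_row y) (cell_sym p) in
  cell_col z.

Section Pi.

Variables (p : Q * Q * Q) (pX : p \in cells).

Lemma pi_funE c : exists r,
  L r (cell_col p) = L (cell_row p) c /\ L r (pi_fun p c) = cell_sym p.
Proof.
rewrite /pi_fun /cell_sym /=; set y := col_sym_cell _ _.
have [yX yc ys] := (col_sym_cellP _ _ _).2 (erefl y).
set z := row_sym_cell _ _.
have [zX zr zs] := (row_sym_cellP _ _ _).2 (erefl z).
exists (cell_row y).
move: yX zX; rewrite !cellsE => /eqP yE /eqP zE; split.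
  by rewrite -yc yE ys.
by rewrite -zr zE zs.
Qed.

Lemma quasigroup_mulI a : injective (L a).
Proof.
move=> b c E; have [[d [_ dU]] _] := HL a (L a c).
by rewrite -(dU b E) -(dU c).
Qed.

Lemma quasigroup_Imul a : injective (L^~ a).
Proof.
move=> b c /= E; have [_ [d [_ dU]]] := HL a (L c a).
by rewrite -(dU b E) -(dU c).
Qed.

Lemma pi_fun_neq c : c != cell_col p -> pi_fun p c != cell_col p.
Proof.
move=> cN; apply: contra cN => /eqP E.
have [r [E1 E2]] := pi_funE c; rewrite E in E2.
move: pX; rewrite cellsE => /eqP pE.
by apply/eqP/(@quasigroup_mulI (cell_row p)); rewrite -E1 E2.
Qed.

Lemma pi_fun_inj : injective (pi_fun p).
Proof.
move=> c d E; have [r [Er1 Er2]] := pi_funE c; have [s [Es1 Es2]] := pi_funE d.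
have rs : r = s by apply: (@quasigroup_Imul (pi_fun p c)); rewrite /= Er2 E Es2.
by apply: (@quasigroup_mulI (cell_row p)); rewrite -Er1 -Es1 rs.
Qed.

Definition pi_sub (c : {c : Q | c != cell_col p}) : {c : Q | c != cell_col p} :=
  exist _ (pi_fun p (val c)) (pi_fun_neq (valP c)).

Lemma pi_sub_inj : injective pi_sub.
Proof. by move=> c d /(congr1 val) /pi_fun_inj /val_inj. Qed.

Definition pi_perm : {perm {c : Q | c != cell_col p}} := perm pi_sub_inj.

End Pi.

End LatinSquare.

(* Main.v *)
Require Import Defs.
From mathcomp Require Import all_boot all_fingroup.

(** With [p = (r, k, rk)], the defining equations of [pi_p] say that the row
    [s] with [sk = rc] satisfies [s (pi_p c) = rk].  If [pi_p c] is
    [(k c^-1) k], this reads [s ((k c^-1) k) = rk] whenever [sk = rc]; it also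
    holds at [c = k], where it is trivial.  Given arbitrary [s], [k] and [b],
    take [c = b^-1] and [r = (sk) b]: the right inverse property gives
    [rc = sk], so [s ((k b) k) = ((sk) b) k], which is the right Bol identity. *)

Lemma quasigroup_inv_involutive {Q : finType} {op : Q -> Q -> Q} {iota : Q}
    {inv : Q -> Q} :
  quasigroup op -> right_inverse_property op iota inv -> involutive inv.
Proof.
move=> HL [inv2 _] b; apply: (quasigroup_mulI HL (a := inv b)).
by rewrite (inv2 (inv b)).1 (inv2 b).2.
Qed.

(** The formula for [pi], rewritten as an identity in the quasigroup; the
    column [c = k], on which [pi] is not defined, is included. *)
Lemma pi_formula_mul {Q : finType} {op : Q -> Q -> Q} {iota : Q}
    {inv : Q -> Q} {HL : quasigroup op}
    (id_l : left_id iota op) (Hinv : right_inverse_property op iota inv)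
    (Hpi : forall (p : Q * Q * Q) (pX : p \in cells op)
             (c : {c : Q | c != cell_col p}),
       val (pi_perm HL pX c)
       = op (op (cell_col p) (inv (val c))) (cell_col p))
    {r s k c : Q} :
  op s k = op r c -> op s (op (op k (inv c)) k) = op r k.
Proof.
move=> E; have [ck | ck] := eqVneq c k.
  rewrite ck in E *; rewrite (Hinv.1 k).1 id_l.
  by rewrite (quasigroup_Imul HL (a := k) E).
have pX : (r, k, op r k) \in cells op by rewrite cellsE.
have := Hpi _ pX (exist _ c ck); rewrite permE /= => <-.
have [s' [Ek Epi]] := pi_funE HL (r, k, op r k) c.
have -> : s = s' by apply: (quasigroup_Imul HL (a := k)); rewrite /= E -Ek.
exact: Epi.
Qed.

Theorem theorem7p4 (Q : finType) (op : Q -> Q -> Q) (iota : Q) (inv : Q -> Q)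
    (HQ : loop op iota) (Hinv : right_inverse_property op iota inv)
    (Hpi : forall (p : Q * Q * Q) (pX : p \in cells op),
       (pi_perm (loop_quasigroup HQ) pX ^+ 2 = 1)%g /\
       forall c : {c : Q | c != cell_col p},
         val (pi_perm (loop_quasigroup HQ) pX c)
         = op (op (cell_col p) (inv (val c))) (cell_col p)) :
  right_bol_loop op iota.
Proof.
split=> // a b c.
have invK := quasigroup_inv_involutive (loop_quasigroup HQ) Hinv.
rewrite -{2}(invK b); symmetry.
apply: (pi_formula_mul (loop_left_id HQ) Hinv (fun p pX => (Hpi p pX).2)).
by rewrite Hinv.2.
Qed.
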